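(* Let $F$ be a perfect field with $\operatorname{char}(F)=2$. Then for every Dedekind Poisson algebra $P$ over $F$, $$[P,P]=0.$$ In particular this holds over every finite field of characteristic $2$.
   Context: A Poisson algebra over a field $F$ is an $F$-vector space $P$ with a bilinear commutative associative multiplication $xy$ (no identity element is assumed) and an alternating Lie bracket $[\,,\,]$ ($[x,x]=0$ for all $x$, also in characteristic $2$) satisfying $[xy,z]=x[y,z]+y[x,z]$. A Poisson subalgebra is a subspace closed under both operations; a Poisson ideal is a subspace $I$ with $PI\subseteq I$ and $[P,I]\subseteq I$. A Poisson algebra is Dedekind if every Poisson subalgebra is a Poisson ideal. No finite-dimensionality is assumed. A field of characteristic $2$ is perfect if $x\mapsto x^2$ is surjective. $[P,P]$ is the linear span of all brackets. *)

(* Defs.v *)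
From HB Require Import structures.
From mathcomp Require Import all_boot all_algebra.
From mathcomp Require Import classical_sets.

Set Implicit Arguments.
Unset Strict Implicit.
Unset Printing Implicit Defensive.

Import GRing.Theory.
Local Open Scope ring_scope.
Local Open Scope classical_set_scope.

(* The product [pmul] has no unit, so it is not a MathComp ring product. *)
HB.mixin Record Lmodule_isPoisson (F : fieldType) P of GRing.Lmodule F P := {
  pmul : P -> P -> P;
  pbr : P -> P -> P;
  pmul_bilinear : bilinear_for *:%R *:%R pmul;
  pmulC : commutative pmul;
  pmulA : associative pmul;
  pbr_bilinear : bilinear_for *:%R *:%R pbr;
  pbrxx : forall x, pbr x x = 0;
  pbr_jacobi : forall x y z,
    pbr x (pbr y z) + pbr y (pbr z x) + pbr z (pbr x y) = 0;
  pbr_leibniz : forall x y z,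
    pbr (pmul x y) z = pmul x (pbr y z) + pmul y (pbr x z)
}.

#[short(type="poissonAlgType")]
HB.structure Definition PoissonAlg (F : fieldType) :=
  { P of Lmodule_isPoisson F P & GRing.Lmodule F P }.

Definition linear_subspace (F : fieldType) (V : lmodType F) (S : set V) : Prop :=
  S 0 /\ forall (a : F) (u v : V), S u -> S v -> S (a *: u + v).

Section Poisson.
Variables (F : fieldType) (P : poissonAlgType F).

Definition poisson_subalgebra (S : set P) : Prop :=
  [/\ linear_subspace S,
      forall x y, S x -> S y -> S (pmul x y) &
      forall x y, S x -> S y -> S (pbr x y)].

Definition poisson_ideal (I : set P) : Prop :=
  [/\ linear_subspace I,
      forall p x, I x -> I (pmul p x) &
      forall p x, I x -> I (pbr p x)].

Definition dedekind : Prop :=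
  forall S : set P, poisson_subalgebra S -> poisson_ideal S.

Definition derived_subspace : set P :=
  smallest (@linear_subspace F P) [set w | exists x y : P, w = pbr x y].

End Poisson.

Arguments dedekind {F} P.
Arguments derived_subspace {F} P.

Definition perfect_char2 (F : fieldType) : Prop :=
  2%N \in [pchar F] /\ forall y : F, exists x : F, y = x ^+ 2.

(* Main.v *)
Require Import Defs.
From mathcomp Require Import all_boot all_algebra.
From mathcomp Require Import classical_sets.

Local Open Scope ring_scope.
Local Open Scope classical_set_scope.

(** Why the bracket vanishes.  In characteristic 2 the Leibniz rule gives
    [x x, z] = 2 x [x, z] = 0, so squares are central for the bracket.

    The subalgebra generated by x^2 is an ideal, hence contains x x^2: there
    is a polynomial f with x^3 = x^2 f(x^2), that is x^2 (x - f(x^2)) = 0.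
    If f has no constant term, x - f(x^2) has cube zero and f(x^2) is central.
    If f has constant term a, nonzero, then
    e = a^-1 (x - f(x^2) + a) satisfies x^2 e = x^2, and E = e^2 is a central
    idempotent with x^2 E = x^2; the line F E is an ideal, so x E is a multiple
    of E, and x - x E has square zero.  In both cases x is the sum of a central
    element and an element with cube zero ([cube_zero_plus_central]), and only
    brackets of elements with cube zero matter.

    If n^3 = 0, then F n + F n^2 is a subalgebra, hence an ideal, so a bracket
    [n, m] is c n + d n^2.  If also m^3 = 0, it is a m + b m^2 too.  Squares
    being central, a [n, m] = [n, a m] = [n, [n, m]] = [n, c n] = 0, so the
    bracket vanishes unless a = 0; hence it is a multiple of m^2, and by
    symmetry of n^2 ([pbr_multiple_of_square]).  Over a perfect field write
    [n, m] = t^2 m^2 = s^2 n^2 and put z = s n + t m; then z^2 = 0 by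
    commutativity and characteristic 2.  So t [n, m] = [n, z] is a multiple of
    z^2 = 0, and [n, m] = t^2 m^2 vanishes whether or not t does. *)

Set Implicit Arguments.
Unset Strict Implicit.

Import GRing.Theory.

Local Notation "x ** y" := (pmul x y) (at level 40, left associativity).
Local Notation "⁅ x , y ⁆" := (pbr x y) (format "⁅ x ,  y ⁆").

(** * Calculus in a Poisson algebra *)

Section Calculus.
Context {F : fieldType} {P : poissonAlgType F}.
Implicit Types (a b : F) (x y z : P).

Lemma pmulDr x y z : x ** (y + z) = x ** y + x ** z.
Proof. by have := (pmul_bilinear (s := P)).2 x 1 y z; rewrite /= !scale1r. Qed.

Lemma pmul0r x : x ** 0 = 0.
Proof. by apply: (addrI (x ** 0)); rewrite -pmulDr !addr0. Qed.

Lemma pmulZr a x y : x ** (a *: y) = a *: (x ** y).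
Proof.
by have := (pmul_bilinear (s := P)).2 x a y 0; rewrite /= pmul0r !addr0.
Qed.

Lemma pmulDl x y z : (y + z) ** x = y ** x + z ** x.
Proof. by rewrite pmulC pmulDr !(pmulC x). Qed.

Lemma pmul0l x : 0 ** x = 0.
Proof. by rewrite pmulC pmul0r. Qed.

Lemma pmulZl a x y : (a *: y) ** x = a *: (y ** x).
Proof. by rewrite pmulC pmulZr pmulC. Qed.

Lemma pbrDr x y z : ⁅x, y + z⁆ = ⁅x, y⁆ + ⁅x, z⁆.
Proof. by have := (pbr_bilinear (s := P)).2 x 1 y z; rewrite /= !scale1r. Qed.

Lemma pbrDl x y z : ⁅y + z, x⁆ = ⁅y, x⁆ + ⁅z, x⁆.
Proof. by have := (pbr_bilinear (s := P)).1 x 1 y z; rewrite /= !scale1r. Qed.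

Lemma pbr0r x : ⁅x, 0⁆ = 0.
Proof. by apply: (addrI ⁅x, 0⁆); rewrite -pbrDr !addr0. Qed.

Lemma pbrC x y : ⁅x, y⁆ = - ⁅y, x⁆.
Proof.
apply/eqP; rewrite -addr_eq0; apply/eqP.
by have := pbrxx (x + y); rewrite pbrDl !pbrDr !pbrxx add0r addr0.
Qed.

Lemma pbr0l x : ⁅0, x⁆ = 0.
Proof. by rewrite pbrC pbr0r oppr0. Qed.

Lemma pbrZr a x y : ⁅x, a *: y⁆ = a *: ⁅x, y⁆.
Proof.
by have := (pbr_bilinear (s := P)).2 x a y 0; rewrite /= pbr0r !addr0.
Qed.

Lemma pbrZl a x y : ⁅a *: y, x⁆ = a *: ⁅y, x⁆.
Proof. by rewrite pbrC pbrZr pbrC scalerN opprK. Qed.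

End Calculus.

(** * Central elements and generated subalgebras *)

Section Subalgebras.
Context {F : fieldType} {P : poissonAlgType F}.
Implicit Types (a b : F) (x y z : P) (S : set P).

Lemma subspaceD S x y : linear_subspace S -> S x -> S y -> S (x + y).
Proof. by move=> [_ lin] hx hy; rewrite -[x]scale1r; apply: lin. Qed.

Lemma subspaceZ S a x : linear_subspace S -> S x -> S (a *: x).
Proof. by move=> [S0 lin] hx; rewrite -[_ *: _]addr0; apply: lin. Qed.

Definition central : set P := [set z | forall y, ⁅z, y⁆ = 0].

Lemma central_subalgebra : poisson_subalgebra central.
Proof.
split; first split=> [y|a u v hu hv y].
- exact: pbr0l.
- by rewrite pbrDl pbrZl hu hv scaler0 addr0.
- by move=> u v hu hv y; rewrite pbr_leibniz hu hv !pmul0r addr0.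
- by move=> u v hu hv y; rewrite hu pbr0l.
Qed.

Lemma pbr_centralr z : central z -> forall y, ⁅y, z⁆ = 0.
Proof. by move=> hz y; rewrite pbrC hz oppr0. Qed.

Definition generated (u : P) : set P :=
  smallest (@poisson_subalgebra F P) [set u].

Lemma generated_subalgebra u : poisson_subalgebra (generated u).
Proof.
split; first split.
- by move=> S [[[]]].
- move=> a v w hv hw S hS; have [[_ lin] _ _] := hS.1.
  by apply: lin; [apply: hv | apply: hw].
- move=> v w hv hw S hS; have [_ mul _] := hS.1.
  by apply: mul; [apply: hv | apply: hw].
- move=> v w hv hw S hS; have [_ _ br] := hS.1.
  by apply: br; [apply: hv | apply: hw].
Qed.

Lemma mem_generated u : generated u u.
Proof. by apply: sub_gen_smallest. Qed.

Lemma generated_central u : central u -> generated u `<=` central.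
Proof.
by move=> hu; apply: smallest_sub; [exact: central_subalgebra | move=> _ ->].
Qed.

(** The subalgebra generated by a central [u] consists of the polynomials in
    [u] without constant term; this factors [u] out of such a polynomial,
    keeping the constant term [a] of the cofactor apart since there is no
    unit. *)
Lemma generated_factor u w : central u -> generated u w ->
  exists a v, generated u v /\ w = a *: u + u ** v.
Proof.
move=> cu; have [glin gmul gbr] := generated_subalgebra u.
have gu : generated u u by exact: mem_generated.
suff sub : generated u `<=`
    [set w | exists a v, generated u v /\ w = a *: u + u ** v] by apply: sub.
apply: smallest_sub => [|_ ->]; last first.
  by exists 1, 0; split; [case: glin | rewrite scale1r pmul0r addr0].
have gP a v : generated u v -> generated u (a *: u + u ** v).
  by move=> hv; apply: glin.2 => //; apply: gmul.
split; first split.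
- by exists 0, 0; split; [case: glin | rewrite scale0r pmul0r addr0].
- move=> c _ _ [a [v [hv ->]]] [a' [v' [hv' ->]]].
  exists (c * a + a'), (c *: v + v'); split; first exact: glin.2.
  by rewrite pmulDr pmulZr scalerDr scalerA scalerDl addrACA.
- move=> _ y [a [v [hv ->]]] [a' [v' [hv' def_y]]].
  have gy : generated u y by rewrite def_y; apply: gP.
  exists 0, (a *: y + v ** y); split.
    by apply: glin.2 => //; apply: gmul.
  by rewrite scale0r add0r pmulDl pmulDr pmulZl pmulZr pmulA.
- move=> _ y [a [v [hv ->]]] _.
  exists 0, 0; split; first by case: glin.
  rewrite scale0r pmul0r addr0.
  by apply: (generated_central cu); apply: gP.
Qed.

Lemma idempotent_line_subalgebra e : e ** e = e ->
  poisson_subalgebra [set w : P | exists c, w = c *: e].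
Proof.
move=> ee; split; first split.
- by exists 0; rewrite scale0r.
- by move=> a _ _ [c ->] [d ->]; exists (a * c + d); rewrite scalerDl scalerA.
- by move=> _ _ [c ->] [d ->]; exists (c * d); rewrite pmulZl pmulZr ee scalerA.
- move=> _ _ [c ->] [d ->]; exists 0.
  by rewrite pbrZl pbrZr pbrxx !scaler0 scale0r.
Qed.

End Subalgebras.

(** * Dedekind algebras in characteristic 2 *)

Section CharacteristicTwo.
Context {F : fieldType} {P : poissonAlgType F}.
Hypothesis char2 : 2%N \in [pchar F].
Implicit Types (a b : F) (x y z n m : P).

Lemma addxx x : x + x = 0.
Proof. by rewrite -mulr2n -scaler_nat (pcharf0 char2) scale0r. Qed.

Lemma oppx x : - x = x.
Proof. by apply: (addrI x); rewrite subrr addxx. Qed.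

Lemma addxK x y : y + x + x = y.
Proof. by rewrite -addrA addxx addr0. Qed.

(** Leibniz gives [2 x [x, y]]. *)
Lemma square_central x : central (x ** x).
Proof. by move=> y; rewrite pbr_leibniz addxx. Qed.

Lemma sqrxD x y : (x + y) ** (x + y) = x ** x + y ** y.
Proof. by rewrite pmulDl !pmulDr (pmulC y x) addrA addxK. Qed.

Lemma cube_zero_span_subalgebra n : n ** n ** n = 0 ->
  poisson_subalgebra [set w : P | exists a b, w = a *: n + b *: (n ** n)].
Proof.
move=> n3; split; first split.
- by exists 0, 0; rewrite !scale0r addr0.
- move=> c _ _ [a [b ->]] [a' [b' ->]]; exists (c * a + a'), (c * b + b').
  by rewrite scalerDr !scalerA !scalerDl addrACA.
- move=> _ _ [a [b ->]] [a' [b' ->]]; exists 0, (a * a').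
  rewrite pmulDl !pmulDr !pmulZl !pmulZr (pmulA (n ** n)) (pmulC n (n ** n)).
  by rewrite n3 pmul0l !scaler0 !addr0 scale0r add0r scalerA.
- move=> _ _ [a [b ->]] [a' [b' ->]]; exists 0, 0.
  rewrite pbrDl !pbrDr !pbrZl !pbrZr pbrxx !(square_central n).
  by rewrite (pbr_centralr (square_central n)) !scaler0 !addr0 !scale0r addr0.
Qed.

Hypothesis ded : dedekind P.

(** The ideal generated by [x ** x] contains [x ** (x ** x)], which is
    therefore a polynomial in [x ** x] with linear coefficient [a].
    When [a = 0], subtracting the resulting quotient [v] from [x] kills the
    cube; when [a != 0], the polynomial relation produces an idempotent that
    absorbs [x ** x]. *)
Lemma cube_zero_plus_central x :
  exists n z, [/\ n ** n ** n = 0, central z & x = n + z].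
Proof.
pose u := x ** x; have cu : central u := square_central x.
have [_ gP _] := ded (generated_subalgebra u).
have [a [v [gv xu]]] := generated_factor cu (gP x u (@mem_generated _ _ u)).
have [b [w [_ def_v]]] := generated_factor cu gv.
have cv : central v := generated_central cu gv.
have uxv : u ** (x + v) = a *: u.
  by rewrite pmulDr (pmulC u x) xu addxK.
(* [v] is divisible by [u], so it is acted on like [u] *)
have v_like_u c y : u ** y = c *: u -> v ** y = c *: v.
  move=> uy; rewrite def_v pmulDl pmulZl -pmulA (pmulC w) pmulA uy pmulZl.
  by rewrite scalerDr !scalerA mulrC.
have [a0|a_neq0] := eqVneq a 0.
  exists (x + v), v; split=> //; last by rewrite addxK.
  rewrite a0 in uxv; have vxv := v_like_u _ _ uxv.
  have nn : (x + v) ** (x + v) = x ** (x + v).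
    by rewrite pmulDl vxv scale0r addr0.
  by rewrite nn -pmulA nn pmulA uxv scale0r.
pose e := a^-1 *: (x + v).
have ue : u ** e = 1 *: u by rewrite pmulZr uxv scalerA mulVf.
have ve := v_like_u _ _ ue; rewrite scale1r in ue; rewrite scale1r in ve.
pose E := e ** e.
have Ee : E ** e = E.
  have -> : E = a^-1 *: (a^-1 *: (u + v ** v)).
    by rewrite /E /e pmulZl pmulZr sqrxD.
  by rewrite !pmulZl pmulDl ue -pmulA ve.
have EE : E ** E = E by rewrite {2}/E pmulA !Ee.
have uE : u ** E = u by rewrite pmulA !ue.
have [_ EP _] := ded (idempotent_line_subalgebra EE).
have [|l xE] := EP x E; first by exists 1; rewrite scale1r.
exists (x + l *: E), (l *: E); split; last by rewrite addxK.
  have u_E : u = l *: (l *: E) by rewrite -uE -pmulA xE pmulZr xE.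
  by rewrite sqrxD -/u u_E pmulZl pmulZr EE addxx pmul0l.
by move=> y; rewrite pbrZl square_central scaler0.
Qed.

(** Both [n] and [m] span, with their squares, an ideal, so the bracket is
    [a *: m + b *: (m ** m)] and also a combination of [n] and [n ** n].
    The latter commutes with [n], hence so does [a *: m]. *)
Lemma pbr_multiple_of_square n m :
  n ** n ** n = 0 -> m ** m ** m = 0 -> exists b, ⁅n, m⁆ = b *: (m ** m).
Proof.
move=> n3 m3.
have [_ _ mP] := ded (cube_zero_span_subalgebra m3).
have [_ _ nP] := ded (cube_zero_span_subalgebra n3).
have [|a [b nm]] := mP n m; first by exists 1, 0; rewrite scale1r scale0r addr0.
have [|c [d mn]] := nP m n; first by exists 1, 0; rewrite scale1r scale0r addr0.
have [a0|a_neq0] := eqVneq a 0; first by exists b; rewrite nm a0 scale0r add0r.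
exists 0; rewrite scale0r; apply: (scalerI a_neq0); rewrite scaler0.
have nn_m : ⁅n, ⁅n, m⁆⁆ = 0.
  rewrite (pbrC n m) oppx mn pbrDr !pbrZr pbrxx.
  by rewrite (pbr_centralr (square_central n)) !scaler0 addr0.
by rewrite -nn_m {2}nm pbrDr !pbrZr (pbr_centralr (square_central m)) scaler0
           addr0.
Qed.

Hypothesis sqrt_ex : forall a, exists s, a = s ^+ 2.

Lemma pbr_cube_zero n m :
  n ** n ** n = 0 -> m ** m ** m = 0 -> ⁅n, m⁆ = 0.
Proof.
move=> n3 m3.
have [b nm] := pbr_multiple_of_square n3 m3.
have [d mn] := pbr_multiple_of_square m3 n3.
have [t def_b] := sqrt_ex b; have [s def_d] := sqrt_ex d.
have [t0|t_neq0] := eqVneq t 0; first by rewrite nm def_b t0 expr0n scale0r.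
(* [s *: n] and [t *: m] have the same square, which cancels in [z ** z] *)
pose z := s *: n + t *: m.
have z2 : z ** z = 0.
  rewrite sqrxD !pmulZl !pmulZr !scalerA -!expr2 -def_b -def_d -nm -mn.
  by rewrite (pbrC n m) oppx addxx.
have z3 : z ** z ** z = 0 by rewrite z2 pmul0l.
have [k nz] := pbr_multiple_of_square n3 z3.
apply: (scalerI t_neq0).
by rewrite scaler0 -(scaler0 _ k) -z2 -nz pbrDr !pbrZr pbrxx scaler0 add0r.
Qed.

Lemma dedekind_pbr_eq0 x y : ⁅x, y⁆ = 0.
Proof.
have [n [z [n3 cz ->]]] := cube_zero_plus_central x.
have [m [w [m3 cw ->]]] := cube_zero_plus_central y.
by rewrite pbrDl cz pbrDr (pbr_centralr cw) pbr_cube_zero // !addr0.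
Qed.

Lemma dedekind_derived_eq0 : derived_subspace P = [set 0].
Proof.
rewrite eqEsubset; split=> [|_ -> S [[]] //].
apply: smallest_sub => [|_ [x [y ->]]]; last exact: dedekind_pbr_eq0.
by split=> // a u v -> ->; rewrite scaler0 addr0.
Qed.

End CharacteristicTwo.

(** The Frobenius map is injective, hence bijective on a finite field. *)
Lemma finField_perfect_char2 (F : finFieldType) :
  2%N \in [pchar F] -> perfect_char2 F.
Proof.
move=> char2; split=> // y.
have frob_inj : injective (fun x : F => x ^+ 2).
  by move=> x1 x2; rewrite -!(pFrobenius_autE char2); apply: fmorph_inj.
have [g _ gK] := injF_bij frob_inj.
by exists (g y); rewrite gK.
Qed.

Theorem corollary8p5 :
  (forall F : fieldType, perfect_char2 F ->
     forall P : poissonAlgType F, dedekind P -> derived_subspace P = [set 0])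
  /\
  (forall F : finFieldType, 2%N \in [pchar F] ->
     forall P : poissonAlgType F, dedekind P -> derived_subspace P = [set 0]).
Proof.
have main (F : fieldType) : perfect_char2 F ->
    forall P : poissonAlgType F, dedekind P -> derived_subspace P = [set 0].
  by move=> [char2 sqrt_ex] P ded; apply: dedekind_derived_eq0.
by split=> [|F char2]; [exact: main | apply/main/finField_perfect_char2].
Qed.
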